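(* Let $\Lambda = \{\lambda_1, \lambda_2, \ldots, \lambda_n\}$ be a list of complex numbers such that $\lambda_1 \in \mathbb{R}$, $\lambda_1 \geq |\lambda_j|$ for $j = 2, \ldots, n$, $\sum_{j=1}^n \lambda_j \geq 0$ and $\overline{\Lambda} = \Lambda$. Let $S \leq n$ be a positive integer and let $\omega_1, \ldots, \omega_S$ be numbers with $0 \leq \omega_k \leq \lambda_1$ for $k = 1, \ldots, S$. Suppose that (1) there is a partition $\Lambda = \Lambda_1 \cup \cdots \cup \Lambda_S$, where $\Lambda_j = \{\lambda_{j1}, \lambda_{j2}, \ldots, \lambda_{jp_j}\}$ for $j = 1, \ldots, S$ and $\lambda_{11} = \lambda_1$, such that at most one of the lists $\Lambda_j$ has odd size, and for each $j = 1, \ldots, S$ the list $\Gamma_j = \{\omega_j, \lambda_{j2}, \ldots, \lambda_{jp_j}\}$ is realizable by a normal centrosymmetric nonnegative matrix with Perron root $\omega_j$; and (2) there is an $S \times S$ normal nonnegative matrix $B$ whose eigenvalues are $\lambda_{11}, \lambda_{21}, \ldots, \lambda_{S1}$ and whose diagonal entries are $\omega_S, \omega_{S-1}, \ldots, \omega_1$ (in this order). Then $\{\lambda_1, \lambda_2, \ldots, \lambda_n\}$ is realizable by a normal centrosymmetric nonnegative matrix.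
   Context: Lists are multisets (repetitions allowed); $\overline{\Lambda}$ is the list of complex conjugates. A list of $k$ complex numbers is realizable by a matrix $A$ if $A$ is a $k \times k$ matrix whose eigenvalues (with multiplicity) are exactly the numbers in the list. A real matrix is nonnegative if all its entries are nonnegative; the Perron root of a nonnegative matrix is its spectral radius, which is an eigenvalue. $J$ denotes the reverse identity matrix of the appropriate size; a square matrix $A$ is centrosymmetric if $JAJ = A$; $A$ is normal if $AA^* = A^*A$. *)

(* Defs.v *)
(* Complex numbers are modelled by an arbitrary
   numClosedFieldType C (e.g. the complex numbers); nonnegativity of an
   entry x is 0 <= x in C (i.e. x is real and nonnegative). *)
From HB Require Import structures.
From mathcomp Require Import all_boot all_order all_algebra spectral.
Set Implicit Arguments. Unset Strict Implicit. Unset Printing Implicit Defensive.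
Import Order.TTheory GRing.Theory Num.Theory.
Local Open Scope ring_scope.

Definition realizes (C : numClosedFieldType) (k : nat) (A : 'M[C]_k) (s : seq C) :=
  char_poly A = \prod_(x <- s) ('X - x%:P).

Definition nonneg_mx (C : numClosedFieldType) (k : nat) (A : 'M[C]_k) :=
  forall i j, 0 <= A i j.

Definition revid_mx (C : numClosedFieldType) (k : nat) : 'M[C]_k :=
  \matrix_(i, j) (j == rev_ord i)%:R.

Definition centrosymmetric (C : numClosedFieldType) (k : nat) (A : 'M[C]_k) :=
  revid_mx C k *m A *m revid_mx C k = A.

Definition perron_root (C : numClosedFieldType) (k : nat) (A : 'M[C]_k) (r : C) :=
  root (char_poly A) r /\ forall z, root (char_poly A) z -> `|z| <= r.

(* Main.v *)
(* Each A_j has a nonnegative unit Perron vector x_j which, by centrosymmetry,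
   can be taken invariant under reversal, and which by normality is also an
   eigenvector of A_j^*.  Let D be the direct sum of the A_j, X the S-row matrix
   with the x_j on its block diagonal, W = diag(omega) and B' the reversal of
   B, whose diagonal is omega_1, ..., omega_S.  Then M = D + X^* (B' - W) X is nonnegative
   and normal, and replaces the eigenvalues omega_j of D by those of B'.  It
   commutes with the block-wise reversal, an involution with at most one
   fixed point, hence conjugate to the reversal of all the indices. *)
Require Import Defs.
From HB Require Import structures.
From mathcomp Require Import all_boot all_order all_algebra all_fingroup.
From mathcomp Require Import spectral.
Import Order.TTheory GRing.Theory Num.Theory.
Set Implicit Arguments. Unset Strict Implicit. Unset Printing Implicit Defensive.
Local Open Scope ring_scope.
Local Open Scope sesquilinear_scope.

(** * Involutions with at most one fixed point *)

(** By induction on [#|D|]: a moved point [x] and its image [f x] go to the two ends of a list for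
    the rest of [D]; once every point is fixed, at most one is left, and it is the centre. *)
Lemma involution_palindrome (T : finType) (f : T -> T) :
    involutive f -> {in [pred x | f x == x] &, forall x y, x = y} ->
  forall D : {set T}, {in D, forall x, f x \in D} ->
  exists s : seq T, [/\ uniq s, s =i D & map f s = rev s].
Proof.
move=> fK fix1 D; have [m] := ubnP #|D|; elim: m D => // m IHm D leDm fD.
have [x /andP[Dx fxNx]|fixD] := pickP [pred x | (x \in D) && (f x != x)]; last first.
  have Dfix x : x \in D -> f x == x.
    by move=> Dx; have /= := fixD x; rewrite Dx => /negbFE.
  have [D0|[x Dx]] := set_0Vmem D.
    by exists [::]; split=> // x; rewrite D0 !inE.
  exists [:: x]; split=> //; last by rewrite /= (eqP (Dfix x Dx)).
  move=> y; rewrite !inE; apply/eqP/idP => [->//|Dy].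
  by apply: fix1; rewrite inE Dfix.
have [||s [Us Ds fs]] := IHm (D :\: [set x; f x]).
- rewrite -ltnS; apply: leq_trans leDm; rewrite ltnS; apply: proper_card.
  rewrite properEneq subsetDl andbT; apply: contraTneq Dx => <-.
  by rewrite !inE eqxx.
- move=> y; rewrite !inE !negb_or -!andbA => /and3P[yNx yNfx Dy].
  by rewrite (can2_eq fK fK) (inj_eq (can_inj fK)) yNfx yNx fD.
exists (x :: rcons s (f x)); split.
- by rewrite /= mem_rcons rcons_uniq inE !Ds Us !inE !eqxx !orbT /= eq_sym (negPf fxNx).
- move=> y; rewrite inE mem_rcons inE Ds !inE.
  have [->|_ /=] := eqVneq y x; first by rewrite Dx.
  by have [->|_] := eqVneq y (f x); rewrite ?fD.
- by rewrite /= map_rcons fK fs rev_cons rev_rcons.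
Qed.

Definition rev_perm n : 'S_n := perm (@rev_ord_inj n).

(** List all indices as [q] with [map s q = rev q] and let [t i] be the [i]-th entry of [q]: then
    [s (t i) = t (rev_ord i)]. *)
Lemma involution_conj_rev n (s : 'S_n) :
    (s * s = 1)%g -> {in [pred x | s x == x] &, forall x y, x = y} ->
  exists t : 'S_n, (rev_perm n * t = t * s)%g.
Proof.
move=> ss fix1.
have sK : involutive s by move=> x; rewrite -permM ss perm1.
have [||q [Uq Tq sq]] := @involution_palindrome _ s sK _ [set: 'I_n].
- by [].
- by move=> x _; rewrite inE.
have size_q : size q = n.
  by rewrite -(card_uniqP Uq) (eq_card Tq) cardsT card_ord.
have [n0|n_gt0] := posnP n.
  by exists 1%g; apply/permP => i; move: (ltn_ord i); rewrite [X in (_ < X)%N]n0.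
pose x0 : 'I_n := Ordinal n_gt0.
have t_inj : injective (fun i : 'I_n => nth x0 q i).
  by move=> i j /eqP; rewrite nth_uniq ?size_q // => /eqP/val_inj.
exists (perm t_inj); apply/permP => i; rewrite !permM !permE.
by rewrite -(nth_map _ x0) ?size_q // sq nth_rev ?size_q.
Qed.

Lemma revid_mxE (C : numClosedFieldType) n :
  revid_mx C n = perm_mx (rev_perm n).
Proof. by apply/matrixP=> i j; rewrite !mxE permE eq_sym. Qed.

(** * Characteristic polynomials of conjugates and of block matrices *)

Lemma char_poly_conj (R : comNzRingType) n (P Q A : 'M[R]_n) :
  P *m Q = 1%:M -> char_poly (P *m A *m Q) = char_poly A.
Proof.
move=> PQ; rewrite /char_poly /char_poly_mx.
have PQP : map_mx polyC P *m map_mx polyC Q = 1%:M by rewrite -map_mxM PQ map_mx1.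
have -> : 'X%:M - map_mx polyC (P *m A *m Q) =
    map_mx polyC P *m ('X%:M - map_mx polyC A) *m map_mx polyC Q.
  rewrite mulmxBr mulmxBl !map_mxM; congr (_ - _).
  by rewrite scalar_mxC -mulmxA PQP mulmx1.
by rewrite !det_mulmx mulrAC -det_mulmx PQP det1 mul1r.
Qed.

Lemma char_poly_ublock (R : comNzRingType) m n (A : 'M[R]_m) B (D : 'M[R]_n) :
  char_poly (block_mx A B 0 D) = char_poly A * char_poly D.
Proof.
rewrite /char_poly /char_poly_mx map_block_mx scalar_mx_block opp_block_mx.
by rewrite add_block_mx map_mx0 subr0 det_ublock.
Qed.

Lemma char_poly_mxdiag (R : comNzRingType) m (p : 'I_m -> nat)
    (A : forall i, 'M[R]_(p i)) :
  char_poly (\mxdiag_i A i) = \prod_i char_poly (A i).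
Proof.
elim: m p A => [|m IHm] p A.
  have char_poly0 n (M : 'M[R]_n) : n = 0%N -> char_poly M = 1.
    by case: n M => // M _; rewrite /char_poly det_mx00.
  by rewrite [RHS]big_ord0 char_poly0 // big_ord0.
have char_poly_cast n n' (e : n = n') (M : 'M[R]_n) :
  char_poly (castmx (e, e) M) = char_poly M by case: _ / e.
rewrite mxdiag_recl [RHS]big_ord_recl -IHm char_poly_cast.
exact: char_poly_ublock.
Qed.

(** * Normal matrices: norm bound, Perron vectors, eigenvalue updates *)

Lemma trmxC_mul (C : numClosedFieldType) m n p (A : 'M[C]_(m, n)) (B : 'M_(n, p)) :
  (A *m B)^t* = B^t* *m A^t*.
Proof. by rewrite trmx_mul map_mxM. Qed.

Lemma mul_trmxCE (C : numClosedFieldType) n (x : 'rV[C]_n) :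
  (x *m x^t*) 0 0 = \sum_i `|x 0 i| ^+ 2.
Proof. by rewrite mxE; apply: eq_bigr => i _; rewrite !mxE normCK. Qed.

Lemma mul_trmxC_ge0 (C : numClosedFieldType) n (x : 'rV[C]_n) :
  0 <= (x *m x^t*) 0 0.
Proof. by rewrite mul_trmxCE sumr_ge0 // => i _; rewrite exprn_ge0. Qed.

Lemma mul_trmxC_eq0 (C : numClosedFieldType) n (x : 'rV[C]_n) :
  ((x *m x^t*) 0 0 == 0) = (x == 0).
Proof.
apply/eqP/eqP => [|->]; last by rewrite mul0mx mxE.
rewrite mul_trmxCE => /eqP; rewrite psumr_eq0 => [/allP x0|i _]; last exact: exprn_ge0.
apply/rowP => i; have := x0 i (mem_index_enum i).
by rewrite mxE expf_eq0 normr_eq0 => /eqP.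
Qed.

(** Normality allows swapping [A] and [A^t*] in the squared norm of [x *m A^t* - r *: x]; as [r] is
    real, every term becomes [r ^+ 2] times the squared norm of [x], and the terms cancel. *)
Lemma normalmx_eigenvector (C : numClosedFieldType) n (A : 'M[C]_n) (r : C) (x : 'rV_n) :
  A \is normalmx -> r \is Num.real -> x *m A = r *: x -> x *m A^t* = r *: x.
Proof.
move=> /normalmxP nA rR xA; apply/eqP; rewrite -subr_eq0 -mul_trmxC_eq0.
have rC : r^* = r by apply/CrealP.
have -> : (x *m A^t* - r *: x)^t* = A *m x^t* - r *: x^t*.
  by rewrite [in LHS]raddfB /= map_mxB trmxC_mul trmxCK linearZ map_mxZ /= rC.
rewrite mulmxBl !mulmxBr !mulmxA -[x *m A^t* *m A]mulmxA -nA mulmxA xA.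
rewrite -!scalemxAl -!scalemxAr -[x *m A^t* *m x^t*]mulmxA.
have -> : A^t* *m x^t* = r *: x^t* by rewrite -trmxC_mul xA linearZ map_mxZ /= rC.
by rewrite xA -!scalemxAr -!scalemxAl !subrr mxE.
Qed.

(** A unitary diagonalization preserves norms and turns [A] into multiplication of the coordinates
    by eigenvalues of modulus at most [r]. *)
Lemma normalmx_norm_bound (C : numClosedFieldType) n (A : 'M[C]_n) (r : C) (x : 'rV_n) :
    A \is normalmx -> (forall z, root (char_poly A) z -> `|z| <= r) ->
  ((x *m A) *m (x *m A)^t*) 0 0 <= r ^+ 2 * (x *m x^t*) 0 0.
Proof.
move=> /orthomx_spectralP Adiag Abound.
have Punit := spectral_unitarymx A.
move: (spectralmx A) (spectral_diag A) Punit Adiag => P d Punit.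
rewrite invmx_unitary // => Adiag.
have PPt : P *m P^t* = 1%:M by apply/unitarymxP.
have PtP : P^t* *m P = 1%:M by apply: mulmx1C.
have char_polyA : char_poly A = \prod_i ('X - (d 0 i)%:P).
  rewrite Adiag char_poly_conj // char_poly_trig ?diag_mx_is_trig //.
  by apply: eq_bigr => i _; rewrite mxE eqxx.
have dbound i : `|d 0 i| <= r.
  apply: Abound; rewrite char_polyA rootE horner_prod (bigD1 i) //=.
  by rewrite hornerXsubC subrr mul0r.
(* The coordinates of [x] in the orthonormal eigenbasis formed by the rows of [P]. *)
pose z := x *m P^t*.
have -> : x *m x^t* = z *m z^t*.
  by rewrite /z trmxC_mul trmxCK mulmxA -[x *m _ *m P]mulmxA PtP mulmx1.
have -> : x *m A *m (x *m A)^t* = (z *m diag_mx d) *m (z *m diag_mx d)^t*.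
  have -> : x *m A = z *m diag_mx d *m P by rewrite Adiag !mulmxA.
  by rewrite [(_ *m P)^t*]trmxC_mul mulmxA -[_ *m P *m P^t*]mulmxA PPt mulmx1.
rewrite !mul_trmxCE mulr_sumr ler_sum // => i _.
rewrite mul_mx_diag mxE normrM exprMn mulrC ler_wpM2r ?exprn_ge0 //.
by rewrite lerXn2r ?nnegrE // (le_trans _ (dbound i)).
Qed.

(* Entrywise [|v| A >= r |v|] for an eigenvector [v], while the norm bound of
   a normal matrix gives the opposite comparison of Euclidean norms. *)
Lemma normalmx_perron_eigenvector (C : numClosedFieldType) n (A : 'M[C]_n) (r : C) :
    A \is normalmx -> nonneg_mx A -> perron_root A r ->
  exists y : 'rV[C]_n, [/\ y != 0, forall i, 0 <= y 0 i & y *m A = r *: y].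
Proof.
move=> nA A0 [rA rbound].
have r0 : 0 <= r by apply: le_trans (rbound r rA).
have := rA; rewrite -eigenvalue_root_char => /eigenvalueP[v vA vN0].
pose y : 'rV[C]_n := map_mx (fun z => `|z|) v.
have y0 i : 0 <= y 0 i by rewrite mxE.
exists y; split=> //.
  apply: contraNneq vN0 => y_eq0; apply/eqP/rowP => i.
  by move/rowP/(_ i)/eqP: y_eq0; rewrite !mxE normr_eq0 => /eqP.
have yAge i : r * y 0 i <= (y *m A) 0 i.
  have /rowP/(_ i) := vA; rewrite !mxE => vAi.
  rewrite -{1}[r]ger0_norm // -normrM -vAi (le_trans (ler_norm_sum _ _ _)) //.
  by apply: ler_sum => j _; rewrite normrM mxE (ger0_norm (A0 _ _)).
have ry0 i : 0 <= r * y 0 i by rewrite mulr_ge0.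
have yA0 i : 0 <= (y *m A) 0 i by apply: le_trans (yAge i).
have sq_ge i : 0 <= (y *m A) 0 i ^+ 2 - (r * y 0 i) ^+ 2.
  by rewrite subr_ge0 lerXn2r ?nnegrE.
(* A sum of nonnegative terms that the norm bound makes nonpositive: every term vanishes, which
   forces [y *m A = r *: y]. *)
have : \sum_i ((y *m A) 0 i ^+ 2 - (r * y 0 i) ^+ 2) == 0.
  rewrite eq_le sumr_ge0 // andbT sumrB subr_le0.
  under eq_bigr do rewrite -[(y *m A) 0 _]ger0_norm //.
  under [leRHS]eq_bigr do rewrite exprMn -[y 0 _]ger0_norm //.
  by rewrite -mulr_sumr -!mul_trmxCE normalmx_norm_bound.
rewrite psumr_eq0 // => /allP yA; apply/rowP => i.
have := yA i (mem_index_enum i); rewrite /= subr_eq0 eqrXn2 // => /eqP ->.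
by rewrite [RHS]mxE.
Qed.

Lemma revid_mxK (C : numClosedFieldType) n : revid_mx C n *m revid_mx C n = 1%:M.
Proof.
rewrite revid_mxE -perm_mxM -perm_mx1; congr perm_mx.
by apply/permP => i; rewrite permM !permE rev_ordK.
Qed.

(** Centrosymmetry makes [A] commute with the reversal [J], so a nonnegative Perron vector [y]
    yields the invariant eigenvector [y + y *m J]; nonnegativity rules out cancellation in this sum,
    which is then normalized. *)
Lemma centrosymmetric_perron_eigenvector (C : numClosedFieldType) n (A : 'M[C]_n) (r : C) :
    A \is normalmx -> centrosymmetric A -> nonneg_mx A -> perron_root A r ->
  exists x : 'rV[C]_n, [/\ forall i, 0 <= x 0 i, x *m revid_mx C n = x,
    x *m A = r *: x & x *m x^t* = 1%:M].
Proof.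
move=> nA cA A0 pr; have [y [yN0 y0 yA]] := normalmx_perron_eigenvector nA A0 pr.
pose J := revid_mx C n; have JK : J *m J = 1%:M by apply: revid_mxK.
have J0 i j : 0 <= J i j by rewrite mxE ler0n.
have JA : J *m A = A *m J by rewrite -[in RHS]cA -!mulmxA JK mulmx1.
have yJ0 i : 0 <= (y *m J) 0 i by rewrite mxE sumr_ge0 // => k _; rewrite mulr_ge0.
pose z := y + y *m J.
have z0 i : 0 <= z 0 i by rewrite mxE addr_ge0.
have zN0 : z != 0.
  apply: contraNneq yN0 => z_eq0; apply/eqP/rowP => i; apply/eqP.
  rewrite mxE eq_le y0 andbT; move/rowP/(_ i): z_eq0; rewrite !mxE => <-.
  by rewrite lerDl; have := yJ0 i; rewrite mxE.
pose c := sqrtC ((z *m z^t*) 0 0).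
have c_gt0 : 0 < c by rewrite sqrtC_gt0 lt_def mul_trmxC_eq0 zN0 mul_trmxC_ge0.
exists (c^-1 *: z); split.
- by move=> i; rewrite mxE mulr_ge0 // invr_ge0 ltW.
- by rewrite -scalemxAl mulmxDl -mulmxA JK mulmx1 addrC.
- rewrite -scalemxAl mulmxDl -mulmxA JA mulmxA yA -scalemxAl -scalerDr.
  by rewrite !scalerA mulrC.
rewrite linearZ map_mxZ /= -scalemxAl -scalemxAr scalerA [z *m _]mx11_scalar.
rewrite -[(z *m _) 0 0]sqrtCK -/c scale_scalar_mx; congr _%:M.
have -> : (c^-1)^* = c^-1 by apply/CrealP; rewrite realV gtr0_real.
by rewrite -expr2 -exprMn mulVf ?expr1n // gt_eqF.
Qed.

(* Conjugating by [1, 0; X, 1] turns the block matrix [M, Y(B-W); 0, W] into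
   [A, Y(B-W); 0, B], where [M] is the matrix on the left-hand side. *)
Lemma char_poly_eigenvalue_update (R : comNzRingType) m n (A : 'M[R]_n)
    (X : 'M_(m, n)) (Y : 'M_(n, m)) (W B : 'M_m) :
    X *m Y = 1%:M -> X *m A = W *m X ->
  char_poly (A + Y *m (B - W) *m X) * char_poly W = char_poly A * char_poly B.
Proof.
move=> XY XA; set D := B - W.
rewrite -(@char_poly_ublock _ _ _ _ (Y *m D)) -(@char_poly_ublock _ _ _ A (Y *m D)).
pose Q := block_mx 1%:M 0 X (1%:M : 'M_m); pose Q' := block_mx 1%:M 0 (- X) (1%:M : 'M_m).
have QQ' : Q *m Q' = 1%:M.
  rewrite mulmx_block !mulmx1 !mul1mx !mulmx0 !mul0mx !addr0 add0r subrr.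
  by rewrite -scalar_mx_block.
rewrite -[LHS](char_poly_conj _ QQ'); congr char_poly.
rewrite !mulmx_block !mulmx1 !mul1mx !mulmx0 !mul0mx !addr0 ?add0r.
have -> : X *m (Y *m D) + W = B by rewrite mulmxA XY mul1mx subrK.
have -> : X *m (A + Y *m D *m X) = B *m X.
  by rewrite mulmxDr XA !mulmxA XY mul1mx -mulmxDl addrC subrK.
by rewrite !mulmxN subrr addrK.
Qed.

(** [A] splits into [Z W], acting on the row span of [X], and a remainder [N] acting on the
    orthogonal complement; replacing [Z W] by [Z B] with [B] normal keeps the sum normal. *)
Lemma normalmx_eigenvalue_update (C : numClosedFieldType) m n (A : 'M[C]_n)
    (X : 'M_(m, n)) (W B : 'M_m) :
    X *m X^t* = 1%:M -> X *m A = W *m X -> X *m A^t* = W *m X -> W^t* = W ->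
    A \is normalmx -> B \is normalmx ->
  A + X^t* *m (B - W) *m X \is normalmx.
Proof.
move=> XX XA XAc Wc /normalmxP nA /normalmxP nB; apply/normalmxP.
have AX : A *m X^t* = X^t* *m W by rewrite -[A]trmxCK -trmxC_mul XAc trmxC_mul Wc.
have AcX : A^t* *m X^t* = X^t* *m W by rewrite -trmxC_mul XA trmxC_mul Wc.
(* Since the rows of [X] are orthonormal, [Z] respects products and adjoints. *)
pose Z (D : 'M_m) := X^t* *m D *m X.
have Zc D : (Z D)^t* = Z (D^t*) by rewrite /Z !trmxC_mul trmxCK mulmxA.
have Zmul D E : Z D *m Z E = Z (D *m E).
  by rewrite /Z !mulmxA -[_ *m X *m X^t*]mulmxA XX mulmx1.
have XZ D : X *m Z D = D *m X by rewrite /Z !mulmxA XX mul1mx.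
have ZX D : Z D *m X^t* = X^t* *m D by rewrite -mulmxA XX mulmx1.
pose N := A - Z W.
have Nc : N^t* = A^t* - Z W by rewrite linearB map_mxB /= Zc Wc.
have NZ F : N *m Z F = 0 by rewrite !mulmxA mulmxBl AX ZX subrr !mul0mx.
have NcZ F : N^t* *m Z F = 0 by rewrite Nc !mulmxA mulmxBl AcX ZX subrr !mul0mx.
have ZN F : Z F *m N = 0 by rewrite -mulmxA mulmxBr XA XZ subrr mulmx0.
have ZNc F : Z F *m N^t* = 0 by rewrite Nc -mulmxA mulmxBr XAc XZ subrr mulmx0.
have AN : A = N + Z W by rewrite subrK.
have MN : A + X^t* *m (B - W) *m X = N + Z B.
  by rewrite /N /Z mulmxBr mulmxBl addrA addrAC.
clearbody N.
have split_mul D E :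
    (N + Z D) *m (N^t* + Z E) = N *m N^t* + Z (D *m E) /\
    (N^t* + Z D) *m (N + Z E) = N^t* *m N + Z (D *m E).
  by rewrite !mulmxDl !mulmxDr NZ NcZ ZN ZNc !Zmul !addr0 !add0r.
(* Normality of [A] gives this after cancelling the common term [Z (W *m W)]. *)
have nN : N *m N^t* = N^t* *m N.
  have [e1 e2] := split_mul W W; move: nA.
  by rewrite AN linearD map_mxD /= Zc Wc e1 e2 => /addIr.
rewrite MN linearD map_mxD /= Zc; have [-> _] := split_mul B (B^t*).
by have [_ ->] := split_mul (B^t*) B; rewrite nN nB.
Qed.

(** * Block-diagonal matrices and the block-wise reversal *)

Section BlockDiagonal.
Variables (m : nat) (p : 'I_m -> nat).

(** Equal block indices give equal sizes, so [conform_mx] acts as a cast and never returns its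
    default [0]. *)
Lemma mxdiagE (V : nmodType) (A : forall i, 'M[V]_(p i)) s t :
  (\mxdiag_i A i) s t = if tagnat.sig1 s == tagnat.sig1 t
    then conform_mx 0 (A (tagnat.sig1 s)) (tagnat.sig2 s) (tagnat.sig2 t) else 0.
Proof. by rewrite mxE; case: eqP => // _; rewrite mxE. Qed.

Lemma map_mxdiag (U V : nmodType) (f : {additive U -> V}) (A : forall i, 'M[U]_(p i)) :
  map_mx f (\mxdiag_i A i) = \mxdiag_i map_mx f (A i).
Proof.
apply/matrixP => s t; rewrite mxE !mxdiagE; case: eqP => _; last exact: raddf0.
by rewrite -[0 in RHS](map_mx0 f) -map_conform_mx [RHS]mxE.
Qed.

Lemma mul_mxdiag (R : pzSemiRingType) (A B : forall i, 'M[R]_(p i)) :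
  \mxdiag_i A i *m \mxdiag_i B i = \mxdiag_i (A i *m B i).
Proof.
rewrite {2}/mxdiag mul_mxdiag_mxblock; apply: eq_mxblock => i j.
by case: eqVneq => [<-|_]; rewrite ?conform_mx_id ?mulmx0.
Qed.

Definition block_rev (s : 'I_(\sum_i p i)) : 'I_(\sum_i p i) :=
  tagnat.Rank _ (rev_ord (tagnat.sig2 s)).

Lemma block_revK : involutive block_rev.
Proof.
move=> s; rewrite /block_rev /tagnat.Rank /tagnat.sig2 /tagnat.sig1 tagnat.rankK /=.
by rewrite rev_ordK -[RHS]tagnat.sigK; case: tagnat.sig.
Qed.

Definition block_rev_perm : 'S_(\sum_i p i) := perm (can_inj block_revK).

Lemma mxdiag_revid (C : numClosedFieldType) :
  \mxdiag_i revid_mx C (p i) = perm_mx block_rev_perm.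
Proof.
apply/matrixP => s t; rewrite mxdiagE !mxE permE -(can_eq tagnat.sigK).
rewrite /block_rev /tagnat.Rank tagnat.rankK /tagnat.sig1 /tagnat.sig2.
case: (tagnat.sig s) (tagnat.sig t) => [i k] [j l] /=.
case: eqVneq l => [<-|ij] l; last first.
  by rewrite -tag_eqE /tag_eq /= (negPf ij).
by rewrite conform_mx_id mxE eq_Tagged /= eq_sym.
Qed.

(** A fixed position [k] in a block of size [p] satisfies [k = p - k.+1], so it is the middle of an
    odd block. *)
Lemma block_rev_fixed s : block_rev s = s -> odd (p (tagnat.sig1 s)) /\
  (tagnat.sig2 s).*2.+1 = p (tagnat.sig1 s).
Proof.
rewrite /block_rev -[X in _ = X -> _]tagnat.sig2K /tagnat.Rank.
move=> /(can_inj tagnat.rankK)/eqP; rewrite eq_Tagged /= => /eqP/(congr1 val) /= e.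
have ks : (tagnat.sig2 s).*2.+1 = p (tagnat.sig1 s).
  by rewrite -addnn -addnS -{1}e subnK //; exact: ltn_ord.
by split=> //; rewrite -ks /= odd_double.
Qed.

(** Fixed indices lie in odd blocks, hence all in the same one, where only the middle is fixed. *)
Lemma block_rev_fixed_uniq : (#|[set i | odd (p i)]| <= 1)%N ->
  {in [pred s | block_rev_perm s == s] &, forall s t, s = t}.
Proof.
move=> /card_le1_eqP odd1 s t; rewrite !inE !permE.
move=> /eqP/block_rev_fixed[os es] /eqP/block_rev_fixed[ot et].
have ij : tagnat.sig1 s = tagnat.sig1 t by apply: odd1; rewrite inE.
apply: (can_inj tagnat.sigK); rewrite !tagnat.sigE12.
move: (tagnat.sig2 s) (tagnat.sig2 t) es et; rewrite -ij => k l ek el.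
by congr Tagged; apply/val_inj/double_inj/succn_inj; rewrite ek el.
Qed.

End BlockDiagonal.

(** * Conjugation by unitary and permutation matrices *)

Lemma rev_permV n : ((rev_perm n)^-1 = rev_perm n)%g.
Proof.
by apply/eqP; rewrite eq_invg_mul; apply/eqP/permP => i; rewrite permM !permE rev_ordK.
Qed.

Lemma nonneg_mul (C : numClosedFieldType) m n q (A : 'M[C]_(m, n)) (B : 'M_(n, q)) :
    (forall i j, 0 <= A i j) -> (forall i j, 0 <= B i j) ->
  forall i j, 0 <= (A *m B) i j.
Proof. by move=> A0 B0 i j; rewrite mxE sumr_ge0 // => k _; rewrite mulr_ge0. Qed.

Lemma normalmx_conj_unitary (C : numClosedFieldType) n (P A : 'M[C]_n) :
  P^t* *m P = 1%:M -> A \is normalmx -> P *m A *m P^t* \is normalmx.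
Proof.
move=> PP /normalmxP nA; apply/normalmxP.
have conjM E F : P *m E *m P^t* *m (P *m F *m P^t*) = P *m (E *m F) *m P^t*.
  by rewrite !mulmxA -[_ *m P^t* *m P]mulmxA PP mulmx1.
have -> : (P *m A *m P^t*)^t* = P *m A^t* *m P^t* by rewrite !trmxC_mul trmxCK mulmxA.
by rewrite !conjM nA.
Qed.

Lemma perm_mxC (C : numClosedFieldType) n (s : 'S_n) :
  (perm_mx s : 'M[C]_n)^t* = perm_mx s^-1.
Proof. by rewrite tr_perm_mx map_perm_mx. Qed.

(** [perm_mx t] intertwines the reversal matrix with [perm_mx s], so invariance of [M] under [s]
    becomes centrosymmetry after relabelling by [t]. *)
Lemma centrosymmetric_relabel (C : numClosedFieldType) n (s t : 'S_n) (M : 'M[C]_n) :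
    (rev_perm n * t = t * s)%g -> (s * s = 1)%g ->
    perm_mx s *m M *m perm_mx s = M ->
  centrosymmetric (perm_mx t *m M *m perm_mx t^-1).
Proof.
move=> rt ss sM; rewrite /centrosymmetric revid_mxE.
have sV : (s^-1 = s)%g by apply/eqP; rewrite eq_invg_mul ss.
have tr : (t^-1 * rev_perm n = s * t^-1)%g by rewrite -{1}rev_permV -invMg rt invMg sV.
by rewrite !mulmxA -perm_mxM rt -[LHS]mulmxA -perm_mxM tr -[in RHS]sM !perm_mxM !mulmxA.
Qed.

Theorem theorem4p2 (C : numClosedFieldType) (Lam : seq C) (S : nat)
    (omega : 'I_S -> C) (Ls : 'I_S -> seq C) (B : 'M[C]_S) :
  (* hypotheses on Lambda = {lambda_1, ..., lambda_n}, lambda_1 = Lam`_0 *)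
  Lam`_0 \is Num.real ->
  (forall j, (0 < j < size Lam)%N -> `|Lam`_j| <= Lam`_0) ->
  0 <= \sum_(x <- Lam) x ->
  perm_eq [seq x^* | x <- Lam] Lam ->
  (* 1 <= S <= n *)
  (0 < S)%N -> (S <= size Lam)%N ->
  (forall k, 0 <= omega k <= Lam`_0) ->
  (* (1) partition Lambda = Lambda_1 u ... u Lambda_S *)
  (forall j, Ls j != [::]) ->
  perm_eq (flatten [seq Ls j | j <- enum 'I_S]) Lam ->
  (forall j : 'I_S, val j = 0%N -> (Ls j)`_0 = Lam`_0) ->
  (#|[set j : 'I_S | odd (size (Ls j))]| <= 1)%N ->
  (forall j, exists A : 'M[C]_(size (Ls j)),
      [/\ A \is normalmx, centrosymmetric A, nonneg_mx A,
          perron_root A (omega j) &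
          realizes A (omega j :: behead (Ls j))]) ->
  (* (2) B normal nonnegative, eigenvalues lambda_11..lambda_S1,
     diagonal omega_S, ..., omega_1 *)
  B \is normalmx -> nonneg_mx B ->
  realizes B [seq (Ls j)`_0 | j <- enum 'I_S] ->
  (forall i, B i i = omega (rev_ord i)) ->
  exists A : 'M[C]_(size Lam),
    [/\ A \is normalmx, centrosymmetric A, nonneg_mx A & realizes A Lam].
Proof.
move=> _ _ _ _ _ _ omega_bd LsN0 permLs _ odd1 exA nB B0 realB Bdiag.
have size_Lam : size Lam = (\sum_j size (Ls j))%N.
  by rewrite -(perm_size permLs) size_flatten /shape -map_comp sumnE big_map big_enum.
(* The first root of each list is kept apart, being the one that takes the place of [omega j]. *)
have prod_Lam : \prod_(x <- Lam) ('X - x%:P) =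
    \prod_j (('X - ((Ls j)`_0)%:P) * \prod_(x <- behead (Ls j)) ('X - x%:P)).
  rewrite -(perm_big _ permLs) big_flatten big_map big_enum /=.
  by apply: eq_bigr => j _; case: (Ls j) (LsN0 j) => //= y s _; rewrite big_cons.
rewrite /realizes prod_Lam; move: (size Lam) size_Lam => n ->.
have /fin_all_exists[A Ap] := exA.
have /fin_all_exists[x xp] : forall j, exists x : 'rV[C]_(size (Ls j)),
    [/\ forall i, 0 <= x 0 i, x *m revid_mx C _ = x, x *m A j = omega j *: x,
        x *m (A j)^t* = omega j *: x & x *m x^t* = 1%:M].
  move=> j; have [nA cA A0 prA _] := Ap j.
  have [y [y0 yJ yA yy]] := centrosymmetric_perron_eigenvector nA cA A0 prA.
  exists y; split=> //; apply: normalmx_eigenvector => //.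
  by rewrite ger0_real //; case/andP: (omega_bd j).
pose D := \mxdiag_j A j.
have Dc : D^t* = \mxdiag_j (A j)^t* by rewrite tr_mxdiag map_mxdiag.
have nD : D \is normalmx.
  apply/normalmxP; rewrite Dc !mul_mxdiag; apply: eq_mxdiag => j.
  by have [/normalmxP] := Ap j.
have D0 : nonneg_mx D.
  move=> s t; rewrite mxdiagE; case: eqP => // e; move: (tagnat.sig2 t).
  by rewrite -e => k; rewrite conform_mx_id; have [_ _ ->] := Ap (tagnat.sig1 s).
(* The column [delta_mx j 0] puts [x j] in row [j], so the rows of [X] are the Perron vectors of the
   blocks, padded with zeros. *)
pose X : 'M_(S, \sum_j size (Ls j)) := \mxrow_j (delta_mx j 0 *m x j).
have X0 i k : 0 <= X i k.
  rewrite mxE; apply: nonneg_mul => [u v|u v]; first by rewrite mxE ler0n.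
  by rewrite ord1; have [->] := xp (tagnat.sig1 k).
have real_tr q q' (Y : 'M[C]_(q, q')) : (forall i k, 0 <= Y i k) -> Y^t* = Y^T.
  by move=> Y0; apply/matrixP => i k; rewrite [LHS]mxE [RHS]mxE mxE geC0_conj.
have XX : X *m X^t* = 1%:M.
  rewrite real_tr // tr_mxrow mul_mxrow_mxcol mx1_sum_delta; apply: eq_bigr => j _.
  have [x0 _ _ _ xx] := xp j; rewrite trmx_mul mulmxA -[_ *m x j *m _]mulmxA.
  rewrite -real_tr => [|i k]; last by rewrite ord1.
  by rewrite xx mulmx1 trmx_delta mul_delta_mx.
pose W : 'M[C]_S := diag_mx (\row_j omega j).
have mulX (E : forall j, 'M[C]_(size (Ls j))) :
    (forall j, x j *m E j = omega j *: x j) -> X *m \mxdiag_j E j = W *m X.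
  move=> xE; rewrite mul_mxrow_mxdiag mul_mxrow; apply: eq_mxrow => j.
  rewrite -mulmxA xE mulmxA -scalemxAr scalemxAl; congr (_ *m _).
  apply/matrixP => u v; rewrite mul_diag_mx !mxE.
  by case: (eqVneq u j) => [->|_] //=; rewrite !mulr0.
have XD : X *m D = W *m X by apply: mulX => j; have [] := xp j.
have XDc : X *m D^t* = W *m X by rewrite Dc; apply: mulX => j; have [] := xp j.
have W0 i j : 0 <= W i j.
  by rewrite !mxE; case: eqP => // _; rewrite mulr1n; case/andP: (omega_bd i).
have Wc : W^t* = W by rewrite real_tr // tr_diag_mx.
pose J := revid_mx C S; have JJ : J *m J = 1%:M by apply: revid_mxK.
have Jc : J^t* = J by rewrite /J revid_mxE perm_mxC rev_permV.
(* The diagonal of [B] lists the [omega] backwards; this conjugation restores their order, so that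
   [B'] and [W] have the same diagonal. *)
pose B' := J *m B *m J.
have B'E i j : B' i j = B (rev_ord i) (rev_ord j).
  by rewrite /B' /J revid_mxE -row_permE -{2}rev_permV -col_permE !mxE !permE.
have nB' : B' \is normalmx.
  by rewrite /B' -[X in _ *m X]Jc normalmx_conj_unitary // Jc.
have char_B' : char_poly B' = \prod_j ('X - ((Ls j)`_0)%:P).
  by rewrite char_poly_conj // realB big_map big_enum.
have BW0 i j : 0 <= (B' - W) i j.
  rewrite [X in _ <= X]mxE [(- W) i j]mxE B'E !mxE; case: eqVneq => [<-|_].
    by rewrite Bdiag rev_ordK subrr.
  by rewrite subr0.
pose M := D + X^t* *m (B' - W) *m X.
have nM : M \is normalmx by apply: normalmx_eigenvalue_update.
have M0 : nonneg_mx M.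
  move=> i j; rewrite mxE addr_ge0 //; apply: nonneg_mul => // {i j}.
  by apply: nonneg_mul => // i j; rewrite real_tr // mxE.
have char_M : char_poly M =
    \prod_j (('X - ((Ls j)`_0)%:P) * \prod_(x <- behead (Ls j)) ('X - x%:P)).
  have char_W : char_poly W = \prod_j ('X - (omega j)%:P).
    rewrite char_poly_trig ?diag_mx_is_trig //.
    by apply: eq_bigr => j _; rewrite !mxE eqxx.
  have char_W0 : char_poly W != 0 by apply/monic_neq0/char_poly_monic.
  (* The update formula determines [char_poly M] up to the nonzero factor [char_poly W]; cancelling
     it removes the roots [omega j]. *)
  apply: (mulIf char_W0); rewrite char_poly_eigenvalue_update // char_poly_mxdiag.
  rewrite char_B' char_W -!big_split /=; apply: eq_bigr => j _.
  have [_ _ _ _ ->] := Ap j; rewrite big_cons.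
  by rewrite mulrC mulrAC -mulrA.
pose s := block_rev_perm (fun j => size (Ls j)).
have ss : (s * s = 1)%g.
  by apply/permP => i; rewrite permM !permE block_revK.
have [t rt] := involution_conj_rev ss (block_rev_fixed_uniq odd1).
pose P : 'M[C]_(\sum_j size (Ls j)) := perm_mx t.
have PP : P *m perm_mx t^-1 = 1%:M by rewrite -perm_mxM mulgV perm_mx1.
exists (P *m M *m perm_mx t^-1); split.
- by rewrite -perm_mxC normalmx_conj_unitary // perm_mxC mulmx1C.
- apply: (centrosymmetric_relabel rt ss); rewrite -mxdiag_revid.
  (* [Sg] is the matrix of [s]. Conjugation by it preserves [D] because each [A j] is
     centrosymmetric, and it fixes the rows of [X] because each [x j] is reversal-invariant; hence
     it preserves [M]. *)
  set Sg := \mxdiag_j _.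
  have XSg : X *m Sg = X.
    rewrite mul_mxrow_mxdiag; apply: eq_mxrow => j; rewrite -mulmxA.
    by have [_ -> _ _ _] := xp j.
  have sV : (s^-1 = s)%g by apply/eqP; rewrite eq_invg_mul ss.
  have Sgt : Sg^T = Sg by rewrite /Sg mxdiag_revid tr_perm_mx sV.
  have SgX : Sg *m X^T = X^T by rewrite -Sgt -trmx_mul XSg.
  rewrite /M [Sg *m _]mulmxDr [LHS]mulmxDl real_tr //; congr (_ + _).
    by rewrite !mul_mxdiag; apply: eq_mxdiag => j; have [_ cA _ _ _] := Ap j.
  by rewrite !mulmxA SgX -mulmxA XSg.
- apply: nonneg_mul => [|i j]; last by rewrite !mxE ler0n.
  by apply: nonneg_mul => // i j; rewrite !mxE ler0n.
- by rewrite char_poly_conj.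
Qed.
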